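(* Let $\mathcal V$ be a variety of loops. Let $X_1,\dots,X_n$ be finite loops such that for every $i$, every subloop $Y\le X_i$ either belongs to $\mathcal V$ or is nonabelian and simple. If an equation $\varepsilon$ (in the signature of loops) propagates in $X_1,\dots,X_n$ and in $\mathcal V$, then it also propagates in the variety $\mathbf{HSP}(X_1,\dots,X_n)\lor\mathcal V$.
   Context: A loop is an algebra $(X,\cdot,\backslash,/,e)$ satisfying $x(x\backslash y)=y=x\backslash(xy)$, $(x/y)y=x=(xy)/y$ and $ex=xe=x$; subloops and homomorphisms are those of this signature. A normal subloop is the kernel of a loop homomorphism. A loop is abelian if it is an abelian group, and nonabelian otherwise (so a nonabelian loop may be commutative). A loop $X$ is simple if its only normal subloops are $\{e\}$ and $X$. A variety is an equationally defined class of algebras; $\mathbf{HSP}(X_1,\dots,X_n)$ is the smallest variety containing $X_1,\dots,X_n$, and $\mathcal V_1\lor\mathcal V_2$ is the smallest variety containing $\mathcal V_1\cup\mathcal V_2$. An equation $\varepsilon=\varepsilon(x_1,\dots,x_m)$ with $m$ variables in the signature of an algebra $X$ propagates in $X$ if for all $x_1,\dots,x_m\in X$: if $\varepsilon(x_1,\dots,x_m)$ holds, then $\varepsilon(y_1,\dots,y_m)$ holds for all $y_1,\dots,y_m$ in the subalgebra $\langle x_1,\dots,x_m\rangle$ of $X$ generated by $x_1,\dots,x_m$. An equation propagates in a class of algebras if it propagates in every member of the class. *)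

(* Defs.v *)
From mathcomp Require Import all_boot.
From mathcomp Require Import boolp classical_sets cardinality.

Set Implicit Arguments.
Unset Strict Implicit.
Unset Printing Implicit Defensive.

Local Open Scope classical_set_scope.

Record loop := Loop {
  carrier :> Type;
  lone : carrier;
  lmul : carrier -> carrier -> carrier;
  ldiv : carrier -> carrier -> carrier; (* ldiv x y is x \ y *)
  rdiv : carrier -> carrier -> carrier; (* rdiv x y is x / y *)
  lmul_ldiv : forall x y, lmul x (ldiv x y) = y;
  ldiv_lmul : forall x y, ldiv x (lmul x y) = y;
  rdiv_lmul : forall x y, lmul (rdiv x y) y = x;
  lmul_rdiv : forall x y, rdiv (lmul x y) y = x;
  lone_mul : forall x, lmul lone x = x;
  lmul_one : forall x, lmul x lone = x
}.

Arguments lone {_}.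

Record is_hom (X Y : loop) (f : X -> Y) : Prop := IsHom {
  hom_one : f lone = lone;
  hom_mul : forall x y, f (lmul x y) = lmul (f x) (f y);
  hom_ldiv : forall x y, f (ldiv x y) = ldiv (f x) (f y);
  hom_rdiv : forall x y, f (rdiv x y) = rdiv (f x) (f y)
}.

Record is_subloop (X : loop) (A : set X) : Prop := IsSubloop {
  sub_one : A lone;
  sub_mul : forall x y, A x -> A y -> A (lmul x y);
  sub_ldiv : forall x y, A x -> A y -> A (ldiv x y);
  sub_rdiv : forall x y, A x -> A y -> A (rdiv x y)
}.

(* A subloop as a loop in its own right; the carrier [set_type A] is
   {x | x \in A}, with boolean membership, so proofs of membership are unique. *)
Section SubloopLoop.
Variables (X : loop) (A : set X) (hA : is_subloop A).

Definition to_sub (x : X) (Ax : A x) : set_type A :=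
  exist (fun u => u \in A) x (mem_set Ax).

Definition sl_one : set_type A := to_sub (sub_one hA).
Definition sl_mul (x y : set_type A) : set_type A :=
  to_sub (sub_mul hA (set_valP x) (set_valP y)).
Definition sl_ldiv (x y : set_type A) : set_type A :=
  to_sub (sub_ldiv hA (set_valP x) (set_valP y)).
Definition sl_rdiv (x y : set_type A) : set_type A :=
  to_sub (sub_rdiv hA (set_valP x) (set_valP y)).

Lemma sl_mul_ldiv x y : sl_mul x (sl_ldiv x y) = y.
Proof. by apply: val_inj; apply: lmul_ldiv. Qed.
Lemma sl_ldiv_mul x y : sl_ldiv x (sl_mul x y) = y.
Proof. by apply: val_inj; apply: ldiv_lmul. Qed.
Lemma sl_rdiv_mul x y : sl_mul (sl_rdiv x y) y = x.
Proof. by apply: val_inj; apply: rdiv_lmul. Qed.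
Lemma sl_mul_rdiv x y : sl_rdiv (sl_mul x y) y = x.
Proof. by apply: val_inj; apply: lmul_rdiv. Qed.
Lemma sl_one_mul x : sl_mul sl_one x = x.
Proof. by apply: val_inj; apply: lone_mul. Qed.
Lemma sl_mul_one x : sl_mul x sl_one = x.
Proof. by apply: val_inj; apply: lmul_one. Qed.

Definition subloop_loop : loop :=
  Loop sl_mul_ldiv sl_ldiv_mul sl_rdiv_mul sl_mul_rdiv sl_one_mul sl_mul_one.

End SubloopLoop.

Definition is_normal (X : loop) (N : set X) : Prop :=
  exists (Z : loop) (f : X -> Z), is_hom f /\ N = [set x | f x = lone].

(* The trivial loop is simple in this sense. *)
Definition simple_loop (X : loop) : Prop :=
  forall N : set X, is_normal N -> N = [set lone] \/ N = [set: X].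

(* An associative loop is a group. *)
Definition abelian_loop (X : loop) : Prop :=
  (forall x y z : X, lmul x (lmul y z) = lmul (lmul x y) z) /\
  (forall x y : X, lmul x y = lmul y x).

Definition finite_loop (X : loop) : Prop := finite_set [set: X].

Inductive term (T : Type) : Type :=
| Var of T
| One
| Mul of term T & term T
| LDiv of term T & term T
| RDiv of term T & term T.

Arguments One {_}.

Fixpoint eval (T : Type) (X : loop) (x : T -> X) (t : term T) : X :=
  match t with
  | Var i => x i
  | One => lone
  | Mul s t => lmul (eval x s) (eval x t)
  | LDiv s t => ldiv (eval x s) (eval x t)
  | RDiv s t => rdiv (eval x s) (eval x t)
  end.

(* An equation with m variables is an [equation 'I_m]. *)
Definition equation (T : Type) : Type := (term T * term T)%type.

Definition holds (T : Type) (X : loop) (eps : equation T) (x : T -> X) : Prop :=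
  eval x eps.1 = eval x eps.2.

(* Identities use variables indexed by nat, so that one set of equations may
   contain identities in arbitrarily many variables. Classes of loops are plain
   predicates: [set loop] would force the universe of carriers strictly below
   that of [set], so that e.g. [set_type A] could not be the carrier of a loop. *)
Definition is_variety (V : loop -> Prop) : Prop :=
  exists E : set (equation nat), forall X : loop,
    V X <-> (forall eps, E eps -> forall x : nat -> X, holds eps x).

(* The intersection of all varieties containing K, which is itself a variety. *)
Definition smallest_variety (K : loop -> Prop) : loop -> Prop :=
  fun X => forall V : loop -> Prop,
    is_variety V -> (forall Y, K Y -> V Y) -> V X.

Definition HSP (n : nat) (X : 'I_n -> loop) : loop -> Prop :=
  smallest_variety (fun Y => exists i, Y = X i).

Definition variety_join (V W : loop -> Prop) : loop -> Prop :=
  smallest_variety (fun X => V X \/ W X).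

(* [smallest C G] is the intersection of all sets containing G with property C. *)
Definition generated_subloop (T : Type) (X : loop) (x : T -> X) : set X :=
  smallest (@is_subloop X) (range x).

Definition propagates (m : nat) (eps : equation 'I_m) (X : loop) : Prop :=
  forall x : 'I_m -> X, holds eps x ->
  forall y : 'I_m -> X, (forall i, generated_subloop x (y i)) -> holds eps y.

Definition propagates_in (m : nat) (eps : equation 'I_m) (K : loop -> Prop) : Prop :=
  forall X : loop, K X -> propagates eps X.

(* Main.v *)
(**
  Let the loop [A] of the join be generated by [x_1, ..., x_m].  Consider the
  congruences of the term algebra in [m] variables whose quotient is a loop.
  The kernel alpha of evaluation at [x] contains the intersection of beta, the
  identities of [V], with finitely many theta_j, the kernels of the valuations
  in the [X_i] that generate a nonabelian simple subloop.  If alpha contains the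
  intersection of gamma and theta, with theta one of the theta_j, then either
  alpha contains gamma, or alpha lies below theta and is the intersection of
  theta with the join of alpha and gamma.  By induction alpha is therefore an
  intersection of some theta_j with a congruence above beta, that is, [A] is a
  subdirect product of a loop of [V] and of subloops of the [X_i], and the
  equation propagates in each factor.
*)
Require Import Defs.
From mathcomp Require Import all_boot.
From mathcomp Require Import boolp classical_sets cardinality.

Set Implicit Arguments.
Unset Strict Implicit.
Unset Printing Implicit Defensive.

Local Open Scope classical_set_scope.

(** * Terms, their values and generated subloops *)

Lemma rdivxx (L : loop) (x : L) : rdiv x x = lone.
Proof. by rewrite -{1}(lone_mul x) lmul_rdiv. Qed.

Lemma rdiv_eq1 (L : loop) (x y : L) : rdiv x y = lone -> x = y.
Proof. by move=> xy1; rewrite -(rdiv_lmul x y) xy1 lone_mul. Qed.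

Fixpoint tsubst (S T : Type) (sigma : S -> term T) (t : term S) : term T :=
  match t with
  | Var i => sigma i
  | One => One
  | Mul s t => Mul (tsubst sigma s) (tsubst sigma t)
  | LDiv s t => LDiv (tsubst sigma s) (tsubst sigma t)
  | RDiv s t => RDiv (tsubst sigma s) (tsubst sigma t)
  end.

Lemma eval_tsubst (S T : Type) (L : loop) (x : T -> L) (sigma : S -> term T)
  (t : term S) : eval x (tsubst sigma t) = eval (fun i => eval x (sigma i)) t.
Proof. by elim: t => //= s -> t ->. Qed.

Lemma eval_hom (T : Type) (L M : loop) (f : L -> M) (x : T -> L) (t : term T) :
  is_hom f -> f (eval x t) = eval (f \o x) t.
Proof.
by case=> f1 fM fL fR; elim: t => //= s <- t <-; rewrite ?fM ?fL ?fR.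
Qed.

Lemma eval_subloop (L : loop) (B : set L) (T : Type) (x : T -> L) (t : term T) :
  is_subloop B -> (forall i, B (x i)) -> B (eval x t).
Proof.
move=> [B1 BM BL BR] Bx.
by elim: t => //= s Bs t Bt; [apply: BM|apply: BL|apply: BR].
Qed.

Lemma range_eval_subloop (T : Type) (L : loop) (x : T -> L) :
  is_subloop (range (eval x)).
Proof.
split=> [|_ _ [s _ <-] [t _ <-]|_ _ [s _ <-] [t _ <-]|_ _ [s _ <-] [t _ <-]].
- by exists One.
- by exists (Mul s t).
- by exists (LDiv s t).
- by exists (RDiv s t).
Qed.

Lemma generated_subloopE (T : Type) (L : loop) (x : T -> L) :
  generated_subloop x = range (eval x).
Proof.
apply/seteqP; split=> [y|_ [t _ <-]].
  apply; split; first exact: range_eval_subloop.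
  by move=> _ [i _ <-]; exists (Var i).
by move=> B [hB xB]; apply: eval_subloop => // i; apply: xB; exists i.
Qed.

(* [lc_loop] makes the quotient of the term algebra a loop: it asks that [R]
   identify any two terms that are equal in all loops. *)
Record loop_cong (T : Type) (R : term T -> term T -> Prop) : Prop := LoopCong {
  lc_loop : forall s t,
    (forall (L : loop) (x : T -> L), eval x s = eval x t) -> R s t;
  lc_sym : forall s t, R s t -> R t s;
  lc_trans : forall s t r, R s t -> R t r -> R s r;
  lc_mul : forall s s' t t', R s s' -> R t t' -> R (Mul s t) (Mul s' t');
  lc_ldiv : forall s s' t t', R s s' -> R t t' -> R (LDiv s t) (LDiv s' t');
  lc_rdiv : forall s s' t t', R s s' -> R t t' -> R (RDiv s t) (RDiv s' t')
}.

(** * Loop congruences of the term algebra *)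

Section LoopCongruences.
Variable T : Type.
Implicit Types (R S : term T -> term T -> Prop) (s t r w : term T).

Lemma lc_refl R : loop_cong R -> forall t, R t t.
Proof. by move=> hR t; apply: lc_loop. Qed.

Lemma lc_rdiv1 R s t : loop_cong R -> R s t -> R (RDiv s t) One.
Proof.
move=> hR Rst; apply: (lc_trans hR (t := RDiv t t)).
  by apply: lc_rdiv => //; apply: lc_refl.
by apply: lc_loop => // L x /=; rewrite rdivxx.
Qed.

Lemma lc_of_rdiv1 R s t : loop_cong R -> R (RDiv s t) One -> R s t.
Proof.
move=> hR Rst; apply: (lc_trans hR (t := Mul (RDiv s t) t)).
  by apply: lc_loop => // L x /=; rewrite rdiv_lmul.
apply: (lc_trans hR (t := Mul One t)).
  by apply: lc_mul => //; apply: lc_refl.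
by apply: lc_loop => // L x /=; rewrite lone_mul.
Qed.

Lemma loop_cong_ker (L : loop) (x : T -> L) :
  loop_cong (fun s t => eval x s = eval x t).
Proof.
split=> [s t|s t|s t r|s s' t t'|s s' t t'|s s' t t'] //=.
- by move=> -> ->.
- by move=> -> ->.
- by move=> -> ->.
- by move=> -> ->.
Qed.

Lemma loop_congI R S :
  loop_cong R -> loop_cong S -> loop_cong (fun s t => R s t /\ S s t).
Proof.
move=> hR hS; split.
- by move=> s t st; split; apply: lc_loop.
- by move=> s t []; split; apply: lc_sym.
- move=> s t r [Rst Sst] [Rtr Str].
  by split; [apply: (lc_trans hR Rst)|apply: (lc_trans hS Sst)].
- by move=> s s' t t' [? ?] [? ?]; split; apply: lc_mul.
- by move=> s s' t t' [? ?] [? ?]; split; apply: lc_ldiv.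
- by move=> s s' t t' [? ?] [? ?]; split; apply: lc_rdiv.
Qed.

Definition rcomp R S s t : Prop := exists2 r, R s r & S r t.

(* Loop congruences permute thanks to the Mal'cev term [(x / y) * z]. *)
Lemma rcompC R S s t : loop_cong R -> loop_cong S -> rcomp R S s t -> rcomp S R s t.
Proof.
move=> hR hS [r Rsr Srt]; exists (Mul (RDiv s r) t).
  apply: (lc_trans hS (t := Mul (RDiv s r) r)).
    by apply: lc_loop => // L x /=; rewrite rdiv_lmul.
  by apply: lc_mul => //; apply: lc_refl.
apply: (lc_trans hR (t := Mul One t)).
  by apply: lc_mul; [|apply: lc_rdiv1|apply: lc_refl].
by apply: lc_loop => // L x /=; rewrite lone_mul.
Qed.

(** Since the two congruences permute, their composite is transitive, so it is their join. *)
Lemma loop_cong_rcomp R S : loop_cong R -> loop_cong S -> loop_cong (rcomp R S).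
Proof.
move=> hR hS; split.
- by move=> s t st; exists s; [apply: lc_refl|apply: lc_loop].
- move=> s t [r Rsr Srt]; apply: rcompC => //.
  by exists r; apply: lc_sym.
- move=> s t w [r Rsr Srt] [r' Rtr' Sr'w].
  have [q Rrq Sqr'] : rcomp R S r r' by apply: rcompC => //; exists t.
  by exists q; [apply: (lc_trans hR Rsr)|apply: (lc_trans hS Sqr')].
- move=> s s' t t' [r ? ?] [r' ? ?].
  by exists (Mul r r'); apply: lc_mul.
- move=> s s' t t' [r ? ?] [r' ? ?].
  by exists (LDiv r r'); apply: lc_ldiv.
- move=> s s' t t' [r ? ?] [r' ? ?].
  by exists (RDiv r r'); apply: lc_rdiv.
Qed.

(** * The quotient loop of a congruence *)

Section Quotient.
Variables (R : term T -> term T -> Prop) (hR : loop_cong R).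

(** Classes are sets of terms, so related terms have equal classes; [rep] picks representatives by
    choice. *)
Definition quot : Type := {C : set (term T) | exists t, C = R t}.
Definition cls (t : term T) : quot := exist _ (R t : set _) (ex_intro _ t erefl).
Definition rep (q : quot) : term T := sval (cid (svalP q)).

Lemma clsP s t : cls s = cls t <-> R s t.
Proof.
split=> [/(congr1 sval) /= -> |Rst]; first exact: lc_refl.
rewrite /cls; apply: eq_exist; apply/seteqP; split=> r /= h.
  by apply: (lc_trans hR _ h); apply: lc_sym.
exact: (lc_trans hR Rst h).
Qed.

Lemma repK (q : quot) : cls (rep q) = q.
Proof.
rewrite /rep; case: cid => t /=; case: q => C hC /= Ct.
by rewrite /cls; apply: eq_exist.
Qed.

Lemma rep_cls t : R (rep (cls t)) t.
Proof. by apply/clsP; rewrite repK. Qed.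

Definition quot_op (op : term T -> term T -> term T) (p q : quot) : quot :=
  cls (op (rep p) (rep q)).

Lemma quot_mulE s t : quot_op (@Mul T) (cls s) (cls t) = cls (Mul s t).
Proof. by apply/clsP; apply: lc_mul => //; apply: rep_cls. Qed.

Lemma quot_ldivE s t : quot_op (@LDiv T) (cls s) (cls t) = cls (LDiv s t).
Proof. by apply/clsP; apply: lc_ldiv => //; apply: rep_cls. Qed.

Lemma quot_rdivE s t : quot_op (@RDiv T) (cls s) (cls t) = cls (RDiv s t).
Proof. by apply/clsP; apply: lc_rdiv => //; apply: rep_cls. Qed.

Definition quotE := (quot_mulE, quot_ldivE, quot_rdivE).

Lemma quot_mul_ldiv p q : quot_op (@Mul T) p (quot_op (@LDiv T) p q) = q.
Proof.
rewrite -(repK p) -(repK q) !quotE; apply/clsP.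
by apply: lc_loop => // L x /=; rewrite lmul_ldiv.
Qed.

Lemma quot_ldiv_mul p q : quot_op (@LDiv T) p (quot_op (@Mul T) p q) = q.
Proof.
rewrite -(repK p) -(repK q) !quotE; apply/clsP.
by apply: lc_loop => // L x /=; rewrite ldiv_lmul.
Qed.

Lemma quot_rdiv_mul p q : quot_op (@Mul T) (quot_op (@RDiv T) p q) q = p.
Proof.
rewrite -(repK p) -(repK q) !quotE; apply/clsP.
by apply: lc_loop => // L x /=; rewrite rdiv_lmul.
Qed.

Lemma quot_mul_rdiv p q : quot_op (@RDiv T) (quot_op (@Mul T) p q) q = p.
Proof.
rewrite -(repK p) -(repK q) !quotE; apply/clsP.
by apply: lc_loop => // L x /=; rewrite lmul_rdiv.
Qed.

Lemma quot_one_mul p : quot_op (@Mul T) (cls One) p = p.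
Proof.
rewrite -(repK p) !quotE; apply/clsP.
by apply: lc_loop => // L x /=; rewrite lone_mul.
Qed.

Lemma quot_mul_one p : quot_op (@Mul T) p (cls One) = p.
Proof.
rewrite -(repK p) !quotE; apply/clsP.
by apply: lc_loop => // L x /=; rewrite lmul_one.
Qed.

Definition quot_loop : loop :=
  Loop quot_mul_ldiv quot_ldiv_mul quot_rdiv_mul quot_mul_rdiv
       quot_one_mul quot_mul_one.

Lemma eval_cls (S : Type) (sigma : S -> term T) (t : term S) :
  @eval S quot_loop (cls \o sigma) t = cls (tsubst sigma t).
Proof.
elim: t => //= s -> t ->; [exact: quot_mulE|exact: quot_ldivE|exact: quot_rdivE].
Qed.

End Quotient.

(** * Maximal congruences with nonabelian quotient *)

(** For a loop congruence [R], the second alternative says that the join of [R] and [S] is the full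
    relation. The full relation itself qualifies as [R], just as the trivial loop counts as
    simple. *)
Definition maximal_cong R : Prop := forall S, loop_cong S ->
  (forall s t, S s t -> R s t) \/ (forall t, exists2 t', R t t' & S t' One).

Definition abelian_cong R : Prop :=
  (forall s t r, R (Mul s (Mul t r)) (Mul (Mul s t) r)) /\
  (forall s t, R (Mul s t) (Mul t s)).

(* Modulo [R], take [s] in the [S1]-class and [t] in the [S2]-class of [One]:
   the two sides of each law then agree both modulo [S1] and modulo [S2]. *)
Lemma abelian_cong_meet R S1 S2 :
  loop_cong R -> loop_cong S1 -> loop_cong S2 ->
  (forall t, exists2 t', R t t' & S1 t' One) ->
  (forall t, exists2 t', R t t' & S2 t' One) ->
  (forall s t, S1 s t /\ S2 s t -> R s t) ->
  abelian_cong R.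
Proof.
move=> hR h1 h2 R1 R2 S12.
have one_l S s t : loop_cong S -> S s One -> S (Mul s t) t.
  move=> hS S1s; apply: (lc_trans hS (t := Mul One t)).
    by apply: lc_mul => //; apply: lc_refl.
  by apply: lc_loop => // L x /=; rewrite lone_mul.
have one_r S s t : loop_cong S -> S s One -> S (Mul t s) t.
  move=> hS S1s; apply: (lc_trans hS (t := Mul t One)).
    by apply: lc_mul => //; apply: lc_refl.
  by apply: lc_loop => // L x /=; rewrite lmul_one.
split=> [s t r|s t]; have [s' Rs s1] := R1 s; have [t' Rt t1] := R2 t.
  apply: (lc_trans hR (t := Mul s' (Mul t' r))).
    by do 2!apply: lc_mul => //; apply: lc_refl.
  apply: (lc_trans hR (t := Mul (Mul s' t') r)); last first.
    apply: lc_mul; [by []| |exact: lc_refl].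
    by apply: (lc_sym hR); apply: lc_mul.
  apply: S12; split.
    apply: (lc_trans h1 (one_l _ _ _ h1 s1)); apply: (lc_sym h1).
    by apply: lc_mul => //; [exact: one_l|exact: lc_refl].
  apply: (lc_trans h2 (t := Mul s' r)).
    by apply: lc_mul => //; [exact: lc_refl|exact: one_l].
  apply: (lc_sym h2).
  by apply: lc_mul => //; [exact: one_r|exact: lc_refl].
apply: (lc_trans hR (t := Mul s' t')); first exact: lc_mul.
apply: (lc_trans hR (t := Mul t' s')); last first.
  by apply: (lc_sym hR); apply: lc_mul.
apply: S12; split.
  by apply: (lc_trans h1 (one_l _ _ _ h1 s1)); apply: (lc_sym h1); apply: one_r.
by apply: (lc_trans h2 (one_r _ _ _ h2 t1)); apply: (lc_sym h2); apply: one_l.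
Qed.

(** When neither [S1] nor [S2] lies below [R], both have full join with [R]. So does their
    intersection, or else [abelian_cong_meet] would make [R] abelian. *)
Lemma meet_maximal_cong R S1 S2 :
  loop_cong R -> maximal_cong R -> ~ abelian_cong R ->
  loop_cong S1 -> loop_cong S2 ->
  (forall s t, S1 s t -> R s t -> S2 s t) ->
  (forall s t, S1 s t -> S2 s t) \/ (forall s t, S2 s t -> R s t).
Proof.
move=> hR maxR nabR h1 h2 S1R.
have [|S2top] := maxR _ h2; first by right.
left=> s t S1st.
have [S1R'|S1top] := maxR _ h1; first by apply: S1R => //; apply: S1R'.
have [S12R|S12top] := maxR _ (loop_congI h1 h2).
  by case: nabR; apply: abelian_cong_meet S12R.
apply: lc_of_rdiv1 => //.
(* [RDiv s t] and [w] are related by [S1] and by [R], hence by [S2], and [w] is in the [S2]-class of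
   [One]. *)
have [w Rw [S1w S2w]] := S12top (RDiv s t).
apply: (lc_trans h2 _ S2w); apply: S1R => //.
by apply: (lc_trans h1 (lc_rdiv1 h1 S1st)); apply: lc_sym.
Qed.

End LoopCongruences.

(** * Propagation as a property of congruences *)

Section Propagation.
Variables (T : Type) (eps : equation T).
Implicit Types R : term T -> term T -> Prop.

(** For a loop congruence [R], this is propagation in the quotient by [R] from the classes of the
    variables, which generate it. *)
Definition cong_propagates R : Prop := R eps.1 eps.2 ->
  forall sigma : T -> term T, R (tsubst sigma eps.1) (tsubst sigma eps.2).

Lemma cong_propagates_meet (I : eqType) (theta : I -> term T -> term T -> Prop)
    (J : seq I) (beta alpha : term T -> term T -> Prop) :
  (forall j, loop_cong (theta j)) ->
  (forall j, j \in J -> [/\ maximal_cong (theta j),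
     ~ abelian_cong (theta j) & cong_propagates (theta j)]) ->
  loop_cong beta ->
  (forall R, loop_cong R -> (forall s t, beta s t -> R s t) ->
     cong_propagates R) ->
  loop_cong alpha ->
  (forall s t, beta s t -> (forall j, j \in J -> theta j s t) -> alpha s t) ->
  cong_propagates alpha.
Proof.
move=> htheta + hbeta betaP.
elim: J alpha => [|k J IH] alpha thetaP halpha Jalpha.
  by apply: betaP => // s t bst; apply: Jalpha.
pose gamma s t := beta s t /\ forall j, j \in J -> theta j s t.
have hgamma : loop_cong gamma.
  split.
  - by move=> s t st; split=> [|j _]; apply: lc_loop.
  - by move=> s t [bst Jst]; split=> [|j /Jst]; apply: lc_sym.
  - move=> s t r [bst Jst] [btr Jtr]; split=> [|j jJ].
      exact: lc_trans btr.
    exact: lc_trans (htheta j) _ _ _ (Jst j jJ) (Jtr j jJ).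
  - move=> s s' t t' [bs Js] [bt Jt]; split=> [|j jJ]; apply: lc_mul => //.
      exact: Js.
    exact: Jt.
  - move=> s s' t t' [bs Js] [bt Jt]; split=> [|j jJ]; apply: lc_ldiv => //.
      exact: Js.
    exact: Jt.
  - move=> s s' t t' [bs Js] [bt Jt]; split=> [|j jJ]; apply: lc_rdiv => //.
      exact: Js.
    exact: Jt.
have [maxk nabk thetakP] := thetaP k (mem_head _ _).
have thetaJ j : j \in J -> [/\ maximal_cong (theta j),
     ~ abelian_cong (theta j) & cong_propagates (theta j)].
  by move=> jJ; apply: thetaP; rewrite inE jJ orbT.
have gammaI s t : gamma s t -> theta k s t -> alpha s t.
  move=> [bst Jst] kst; apply: Jalpha => // j.
  by rewrite inE => /predU1P[->|/Jst].
have [galpha|alphak] :=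
  meet_maximal_cong (htheta k) maxk nabk hgamma halpha gammaI.
  by apply: IH => // s t bst Jst; apply: galpha.
(* The join of [alpha] and [gamma] lies above [gamma], so the induction hypothesis covers it; this
   is why the induction keeps [alpha] general. *)
have agP : cong_propagates (rcomp alpha gamma).
  apply: IH => //; first exact: loop_cong_rcomp.
  by move=> s t bst Jst; exists s; [apply: lc_refl|].
move=> aeps sigma.
have [|r ar gr] := agP _ sigma.
  by exists eps.2 => //; apply: lc_refl.
(* [r] and the right-hand instance are related by [gamma], and also by [theta k], which contains
   [alpha] and propagates the equation. *)
apply: (lc_trans halpha ar); apply: gammaI => //.
apply: (lc_trans (htheta k) (t := tsubst sigma eps.1)).
  exact/(lc_sym (htheta k))/alphak.
by apply: thetakP; apply: alphak.
Qed.

End Propagation.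

(** * Kernels of valuations in a loop *)

Section Kernels.
Variables (T : Type) (L : loop) (f : T -> L).

Let ker s t := eval f s = eval f t.
Let Y := subloop_loop (range_eval_subloop f).

Let toY (t : term T) : Y := to_sub (imageT (eval f) t).

Let repY (y : Y) : {t | eval f t = val y}.
Proof. by apply: cid; have [t _ <-] := set_valP y; exists t. Qed.

Let toY_surj (y : Y) : exists t, y = toY t.
Proof. by have [t ty] := repY y; exists t; apply: val_inj. Qed.

(** As [rcomp ker S] contains [ker], sending [eval f t] to the class of [t] is a homomorphism on
    [Y]. By simplicity its kernel is trivial, and then [S] is below [ker], or all of [Y], and then
    the join is full. *)
Lemma simple_maximal_cong : simple_loop Y -> maximal_cong ker.
Proof.
move=> simpleY S hS.
have hker : loop_cong ker by exact: loop_cong_ker.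
have hR := loop_cong_rcomp hker hS.
have kerR s t : ker s t -> rcomp ker S s t.
  by move=> st; exists t => //; apply: lc_refl.
pose g (y : Y) : quot_loop hR := cls _ (sval (repY y)).
have gE y t : eval f t = val y -> g y = cls _ t.
  move=> ty; apply/(clsP hR); apply: kerR.
  by rewrite /ker ty; case: (repY y).
have g_toY t : g (toY t) = cls _ t by exact: gE.
have g_hom : is_hom g.
  split=> [|x y|x y|x y].
  - exact: (gE _ One).
  - rewrite (gE _ (Mul (sval (repY x)) (sval (repY y)))).
      by rewrite /g /= quot_mulE.
    by rewrite /=; case: (repY x) => /= ? ->; case: (repY y) => /= ? ->.
  - rewrite (gE _ (LDiv (sval (repY x)) (sval (repY y)))).
      by rewrite /g /= quot_ldivE.
    by rewrite /=; case: (repY x) => /= ? ->; case: (repY y) => /= ? ->.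
  - rewrite (gE _ (RDiv (sval (repY x)) (sval (repY y)))).
      by rewrite /g /= quot_rdivE.
    by rewrite /=; case: (repY x) => /= ? ->; case: (repY y) => /= ? ->.
have [N1|NT] := simpleY [set y | g y = lone]
                  (ex_intro _ _ (ex_intro _ g (conj g_hom erefl))).
  left=> s t Sst.
  have : [set y | g y = lone] (toY (RDiv s t)).
    rewrite /= g_toY; apply/(clsP hR); exists (RDiv s t) => //.
    exact: lc_rdiv1.
  by rewrite N1 => /(congr1 val) /=; apply: rdiv_eq1.
right=> t.
have : [set y | g y = lone] (toY t) by rewrite NT.
by rewrite /= g_toY => /(clsP hR) [r tr Sr]; exists r.
Qed.

Lemma abelian_range_eval : abelian_cong ker -> abelian_loop Y.
Proof.
move=> [kA kC]; split=> [x y z|x y].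
  have [s ->] := toY_surj x; have [t ->] := toY_surj y.
  by have [r ->] := toY_surj z; apply: val_inj; apply: kA.
have [s ->] := toY_surj x; have [t ->] := toY_surj y.
by apply: val_inj; apply: kC.
Qed.

(** [f] factors through [Y]. This serves the valuations for which [Y] belongs to the given
    variety. *)
Lemma range_eval_identity (s t : term T) :
  (forall y : T -> Y, eval y s = eval y t) -> eval f s = eval f t.
Proof.
move=> /(_ (toY \o @Var T)) /(congr1 val).
have val_hom : @is_hom Y L val by split.
by rewrite !(eval_hom _ _ val_hom).
Qed.

End Kernels.

Lemma kernel_propagates (m : nat) (eps : equation 'I_m) (L : loop)
    (f : 'I_m -> L) : propagates eps L ->
  cong_propagates eps (fun s t => eval f s = eval f t).
Proof.
move=> epsL epsf sigma; rewrite !eval_tsubst; apply: (epsL _ epsf) => i.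
by rewrite generated_subloopE; exists (sigma i).
Qed.

(** * Identities and varieties *)

Section Identities.
Variable V : loop -> Prop.

Definition identities (T : Type) (s t : term T) : Prop :=
  forall (L : loop) (x : T -> L), V L -> eval x s = eval x t.

Lemma loop_cong_identities (T : Type) : loop_cong (@identities T).
Proof.
split=> [s t st L x _|s t st L x VL|s t r st tr L x VL
        |s s' t t' ss tt L x VL|s s' t t' ss tt L x VL|s s' t t' ss tt L x VL] //=.
- by rewrite st.
- by rewrite st // tr.
- by rewrite ss // tt.
- by rewrite ss // tt.
- by rewrite ss // tt.
Qed.

(** A valuation in the quotient lifts to terms along [rep], so a defining identity of [V] becomes a
    substitution instance, again an identity of [V]. *)
Lemma quot_loop_variety (T : Type) (R : term T -> term T -> Prop)
    (hR : loop_cong R) :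
  is_variety V -> (forall s t, identities s t -> R s t) -> V (quot_loop hR).
Proof.
move=> [E VE] VR; apply/VE => e Ee x.
have -> : x = cls R \o (fun k => rep (x k)).
  by apply: funext => k /=; rewrite repK.
rewrite /holds !eval_cls; apply/(clsP hR); apply: VR => L y /VE VL.
by rewrite !eval_tsubst; apply: VL.
Qed.

Lemma above_identities_propagates (m : nat) (eps : equation 'I_m)
    (R : term 'I_m -> term 'I_m -> Prop) :
  is_variety V -> propagates_in eps V -> loop_cong R ->
  (forall s t, identities s t -> R s t) -> cong_propagates eps R.
Proof.
move=> hV epsV hR VR Reps sigma.
have tsubst_var (t : term 'I_m) : tsubst (@Var 'I_m) t = t.
  by elim: t => //= s -> t ->.
(* The classes of the variables generate the quotient, so propagation from them reaches every
   substitution. *)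
have := epsV _ (quot_loop_variety hR hV VR) (cls R \o (@Var 'I_m)).
rewrite {1}/holds !eval_cls !tsubst_var.
move=> /(_ (proj2 (clsP hR _ _) Reps) (cls R \o sigma)).
rewrite /holds !eval_cls => h; apply/(clsP hR); apply: h => i.
rewrite generated_subloopE; exists (sigma i) => //.
by rewrite eval_cls tsubst_var.
Qed.

End Identities.

(** The models of a single identity form a variety. *)
Lemma smallest_variety_identity (K : loop -> Prop) (m : nat) (s t : term 'I_m)
    (A : loop) (x : 'I_m -> A) :
  identities K s t -> smallest_variety K A -> eval x s = eval x t.
Proof.
move=> Kst KA.
pose W (L : loop) := forall y : 'I_m -> L, eval y s = eval y t.
suff: W A by apply.
apply: KA => [|L KL y]; last exact: Kst.
pose e : equation nat :=
  (tsubst (fun i : 'I_m => Var (val i)) s, tsubst (fun i : 'I_m => Var (val i)) t).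
exists [set e] => L; split=> [WL _ -> y|We y].
  by rewrite /holds !eval_tsubst.
(* Variables of index [m] or more do not occur in [e]; [lone] is an arbitrary value for them. *)
have := We e erefl (fun k => if insub k is Some i then y i else lone).
rewrite /holds !eval_tsubst /=.
rewrite (_ : (fun i : 'I_m => _) = y) //.
by apply: funext => i; rewrite valK.
Qed.

(** * Finitely many valuations and the join of the varieties *)

Lemma finite_loop_enum (L : loop) : finite_loop L ->
  exists (N : nat) (g : 'I_N -> L), forall x, exists k, g k = x.
Proof.
move=> [N /card_set_bijP[f [f_lt f_inj f_surj]]].
have /choice[g gP] (k : 'I_N) : exists x, f x = k.
  by have [x _ <-] := f_surj k (ltn_ord k); exists x.
exists N, g => x; exists (Ordinal (f_lt x I)).
by apply: f_inj; rewrite ?in_setT // gP.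
Qed.

Theorem corollary5p7 (V : loop -> Prop) (n : nat) (X : 'I_n -> loop)
    (m : nat) (eps : equation 'I_m)
    (hV : is_variety V)
    (finX : forall i, finite_loop (X i))
    (subX : forall i (Y : set (X i)) (hY : is_subloop Y),
       V (subloop_loop hY) \/
       (~ abelian_loop (subloop_loop hY) /\ simple_loop (subloop_loop hY)))
    (epsX : forall i, propagates eps (X i))
    (epsV : propagates_in eps V) :
  propagates_in eps (variety_join (HSP X) V).
Proof.
have /choice[N NP] i : exists N, exists g : 'I_N -> X i, forall x, exists k, g k = x.
  exact: finite_loop_enum.
have [g gP] : {g : forall i, 'I_(N i) -> X i | forall i x, exists k, g i k = x}.
  by exists (fun i => sval (cid (NP i))) => i; case: cid.
(* [I] codes all valuations of the [m] variables in the [X i]; finiteness of these loops makes it a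
   finite type. *)
pose I : finType := {i : 'I_n & {ffun 'I_m -> 'I_(N i)}}.
pose f (j : I) (k : 'I_m) := g (tag j) (tagged j k).
pose theta j s t := eval (f j) s = eval (f j) t.
(* By [subX], the valuations in [J] generate nonabelian simple subloops. *)
pose J := [seq j <- enum I | ~~ `[< V (subloop_loop (range_eval_subloop (f j))) >]].
move=> A jA x epsx y xy.
have /choice[sigma sigmaP] k : exists t, eval x t = y k.
  by have := xy k; rewrite generated_subloopE => -[t _ <-]; exists t.
suff xP : cong_propagates eps (fun s t => eval x s = eval x t).
  have := xP epsx sigma; rewrite !eval_tsubst.
  by rewrite (_ : (fun i => _) = y) //; apply: funext.
apply: (@cong_propagates_meet _ _ I theta J (@identities V 'I_m)).
- by move=> j; exact: loop_cong_ker.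
- move=> j; rewrite mem_filter => /andP[/asboolPn nVj _].
  have [//|[nab simp]] := subX _ _ (range_eval_subloop (f j)).
  split; first exact: simple_maximal_cong.
    by move=> /abelian_range_eval.
  exact: kernel_propagates.
- exact: loop_cong_identities.
- by move=> R hR; apply: above_identities_propagates.
- exact: loop_cong_ker.
move=> s t Vst Jst.
(* It suffices to have [s] and [t] agree throughout [V] and every [X i]: the identity then passes to
   [HSP X] and on to the join. *)
apply: smallest_variety_identity jA => L z [HL|VL]; last exact: Vst.
apply: smallest_variety_identity HL => {}L {}z [i Li]; subst L.
have /choice[h hP] k : exists a, g i a = z k by exact: gP.
pose j : I := Tagged (fun i => {ffun 'I_m -> 'I_(N i)}) [ffun k => h k].
have -> : z = f j by apply: funext => k; rewrite /f /= ffunE hP.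
(* A valuation outside [J] generates a loop of [V], where [Vst] applies. *)
have [jJ|] := boolP (j \in J); first exact: (Jst j jJ).
rewrite mem_filter mem_enum andbT negbK => /asboolP Vj.
by apply: range_eval_identity => y'; apply: Vst Vj.
Qed.
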